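(* Let $k\ge 1$ and $d\ge 0$ be integers, let $N$ be the number of monomials of degree $d$ in $x_1,\dots,x_k$, and let $\phi$ be a linear isomorphism from $\mathcal{P}_k^d$ to the standard vector space $V=\mathbb{F}_2^N$. Let $$\mathcal{H}_d(\mathcal{P}_k)=\{\,Sq^{2^j}(m)\;\mid\; j\ge 0,\ m\text{ is a monomial in }\mathcal{P}_k,\ \deg(m)=d-2^j\,\},$$ a spanning set for the subspace $(\mathcal{A}^+\mathcal{P}_k)_d$ of hit polynomials of degree $d$. Let $M$ be the matrix over $\mathbb{F}_2$ with $N$ rows whose columns are the vectors $\phi(h)$ for all $h\in\mathcal{H}_d(\mathcal{P}_k)$. Then $$\dim_{\mathbb{F}_2}\big((\mathcal{A}^+\mathcal{P}_k)_d\big)=\operatorname{rank}(M).$$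
   Context: $\mathcal{P}_k=\mathbb{F}_2[x_1,\dots,x_k]$ is the polynomial algebra in $k$ variables, each of degree $1$, over the field $\mathbb{F}_2$, graded by degree; $\mathcal{P}_k^d$ is the $\mathbb{F}_2$-vector space of homogeneous polynomials of degree $d$ in $\mathcal{P}_k$ (together with $0$). The mod-2 Steenrod algebra $\mathcal{A}$ is generated by the Steenrod squares $Sq^i$, $i\ge 0$, and acts on $\mathcal{P}_k$ in the standard way: $Sq^i$ is $\mathbb{F}_2$-linear and raises degree by $i$; $Sq^0$ is the identity; $Sq^1(x_j)=x_j^2$ and $Sq^i(x_j)=0$ for $i>1$; $Sq^i(1)=0$ for $i>0$; and the Cartan formula $Sq^n(fg)=\sum_{i+j=n}Sq^i(f)Sq^j(g)$ holds. $\mathcal{A}^+$ denotes the augmentation ideal of $\mathcal{A}$. A polynomial $f\in\mathcal{P}_k^d$ is hit if it lies in $\mathcal{A}^+\mathcal{P}_k$, i.e. if it can be written as a finite sum $f=\sum_{i>0}Sq^i(g_i)$ with $g_i\in\mathcal{P}_k^{d-i}$. The set of all hit polynomials of degree $d$ is a vector subspace of $\mathcal{P}_k^d$, denoted $(\mathcal{A}^+\mathcal{P}_k)_d$. *)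

(* Defs.v *)
From HB Require Import structures.
From mathcomp Require Import all_boot all_order all_algebra.
From mathcomp Require Import mpoly.

Set Implicit Arguments.
Unset Strict Implicit.
Unset Printing Implicit Defensive.

Import GRing.Theory.
Local Open Scope ring_scope.

(* The action of the Steenrod squares Sq^i on F_2[x_1, ..., x_k]. These
   properties determine Sq; [steenrod_sqP] below shows they are satisfiable. *)
Record steenrod_squares (k : nat)
    (Sq : nat -> {linear {mpoly 'F_2[k]} -> {mpoly 'F_2[k]}}) : Prop :=
  SteenrodSquares {
    Sq_homog : forall (i d : nat) (p : {mpoly 'F_2[k]}),
      p \is d.-homog -> Sq i p \is (d + i).-homog;
    Sq_id : forall p : {mpoly 'F_2[k]}, Sq 0%N p = p;
    Sq_var1 : forall j : 'I_k, Sq 1%N 'X_j = 'X_j ^+ 2;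
    Sq_var_gt1 : forall (i : nat) (j : 'I_k), (1 < i)%N -> Sq i 'X_j = 0;
    Sq_one : forall i : nat, (0 < i)%N -> Sq i 1 = 0;
    Sq_Cartan : forall (n : nat) (f g : {mpoly 'F_2[k]}),
      Sq n (f * g) = \sum_(i < n.+1) Sq i f * Sq (n - i)%N g }.

(* Only i <= d occurs in the sum, so the truncation in d - i is harmless. *)
Definition hit (k : nat)
    (Sq : nat -> {linear {mpoly 'F_2[k]} -> {mpoly 'F_2[k]}})
    (d : nat) (f : dhomog k 'F_2 d) : Prop :=
  exists g : forall i : nat, dhomog k 'F_2 (d - i),
    (f : {mpoly 'F_2[k]}) = \sum_(1 <= i < d.+1) Sq i (g i).

(* Sq^i as a map from degree d - i to degree d. For i <= d the projection onto
   degree d does nothing, Sq^i (g) being already homogeneous of degree d. *)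
Definition Sq_into (k : nat)
    (Sq : nat -> {linear {mpoly 'F_2[k]} -> {mpoly 'F_2[k]}})
    (d i : nat) (g : dhomog k 'F_2 (d - i)) : dhomog k 'F_2 d :=
  DHomog (pihomogP mdeg d (Sq i g)).

(* The subspace of hit polynomials of degree d; see [mem_hit_space]. The number
   of variables is a successor because [dhomog k.+1 _ d] is the library's
   finite-dimensional vector space. *)
Definition hit_space (k : nat)
    (Sq : nat -> {linear {mpoly 'F_2[k.+1]} -> {mpoly 'F_2[k.+1]}})
    (d : nat) : {vspace dhomog k.+1 'F_2 d} :=
  (\sum_(1 <= i < d.+1) limg (linfun (@Sq_into k.+1 Sq d i)))%VS.

(* Membership in H_d(P_k). The condition deg m = d - 2^j lives in Z (no such m
   when d < 2^j), hence the additive form. *)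
Definition in_hit_gen (k : nat)
    (Sq : nat -> {linear {mpoly 'F_2[k]} -> {mpoly 'F_2[k]}})
    (d : nat) (h : {mpoly 'F_2[k]}) : Prop :=
  exists (j : nat) (m : 'X_{1..k}),
    (mdeg m + 2 ^ j)%N = d /\ h = Sq (2 ^ j)%N 'X_[m].

Definition nb_monomials (k d : nat) : nat :=
  #|[set m : 'X_{1..k < d.+1} | mdeg m == d]|.

Lemma Sq_into_is_linear k Sq d i : linear (@Sq_into k Sq d i).
Proof. by move=> c p q; apply/val_inj; rewrite /= !linearP. Qed.

HB.instance Definition _ k Sq d i :=
  GRing.isLinear.Build 'F_2 _ _ _ (@Sq_into k Sq d i)
    (@Sq_into_is_linear k Sq d i).

Lemma mem_hit_space k Sq d (f : dhomog k.+1 'F_2 d) :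
  steenrod_squares Sq -> (f \in hit_space Sq d) <-> hit Sq f.
Proof.
move=> hSq.
have val_into i (g : dhomog k.+1 'F_2 (d - i)) : (i <= d)%N ->
    (Sq_into Sq g : {mpoly 'F_2[k.+1]}) = Sq i g.
  move=> id; rewrite /= pihomog_dE //.
  rewrite -[X in X.-homog](subnK id).
  by apply: (Sq_homog hSq); apply: dhomog_is_dhomog.
rewrite /hit_space big_add1 /= big_mkord; split.
- move=> /memv_sumP[u hu ->].
  have hg i : exists g : dhomog k.+1 'F_2 (d - i),
      [forall j : 'I_d, (j.+1 == i) ==> (u j == Sq_into Sq g)].
    case: (ltnP i.-1 d) => [lt_i|ge_i]; last first.
      exists 0; apply/forallP => j; apply/implyP => /eqP e.
      by move: ge_i; rewrite -e /= leqNgt ltn_ord.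
    case: i lt_i => [|i] lt_i.
      by exists 0; apply/forallP.
    have /memv_imgP[g _ eg] := hu (Ordinal lt_i) isT.
    exists g; apply/forallP => j; apply/implyP => /eqP[e].
    have -> : j = Ordinal lt_i by apply/val_inj.
    by rewrite eg lfunE.
  exists (fun i => xchoose (hg i)).
  rewrite big_add1 /= big_mkord linear_sum /=; apply: eq_bigr => j _.
  have /forallP/(_ j) := xchooseP (hg j.+1); rewrite eqxx => /eqP ->.
  by rewrite val_into.
- move=> [g eg].
  have -> : f = \sum_(i < d) linfun (@Sq_into _ Sq d i.+1) (g i.+1).
    apply/val_inj; rewrite /= eg big_add1 /= big_mkord linear_sum /=.
    by apply: eq_bigr => i _; rewrite lfunE val_into.
  by apply: memv_sumr => i _; apply: memv_img; apply: memvf.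
Qed.

(* Sq^i (p) is the coefficient of t^i in p(x_1 + x_1^2 t, ..., x_k + x_k^2 t). *)
Definition total_sq (k : nat) : {mpoly 'F_2[k]} -> {poly {mpoly 'F_2[k]}} :=
  mmap (polyC \o @mpolyC k 'F_2) (fun j => ('X_j)%:P + ('X_j ^+ 2)%:P * 'X).

Definition steenrod_sq (k i : nat) (p : {mpoly 'F_2[k]}) : {mpoly 'F_2[k]} :=
  (total_sq p)`_i.

Lemma steenrod_sq_is_linear k i : linear (@steenrod_sq k i).
Proof.
move=> c p q; rewrite /steenrod_sq /total_sq mmapD mmapZ coefD /=.
by rewrite coefCM mul_mpolyC.
Qed.

HB.instance Definition _ k i :=
  GRing.isLinear.Build 'F_2 _ _ _ (@steenrod_sq k i) (@steenrod_sq_is_linear k i).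

Lemma total_sqX k (m : 'X_{1..k}) :
  total_sq 'X_[m] = \prod_(j < k) (('X_j)%:P + ('X_j ^+ 2)%:P * 'X) ^+ m j.
Proof. by rewrite /total_sq mmapX. Qed.

Lemma steenrod_sqP k : steenrod_squares (fun i => @steenrod_sq k i).
Proof.
have var j i : steenrod_sq i 'X_j =
    'X_j *+ (i == 0%N) + 'X_j ^+ 2 *+ (i == 1%N) :> {mpoly 'F_2[k]}.
  rewrite /steenrod_sq /total_sq mmapX mmap1U coefD coefC coefMX coefC.
  by case: i => [|[|i]]; rewrite /= ?mulr0n ?mulr1n.
have sq1 : total_sq 1 = 1 :> {poly {mpoly 'F_2[k]}}.
  by rewrite /total_sq -mpolyC1 mmapC /= mpolyC1.
split.
- move=> i d p /dhomogP hp; rewrite [p]mpolyE linear_sum big_seq /=.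
  apply: rpred_sum => m /hp hm; rewrite linearZ rpredZ //= -hm {p d hp hm}.
  pose Q (d : nat) (P : {poly {mpoly 'F_2[k]}}) :=
    forall i, P`_i \is (d + i).-homog.
  have Q1 : Q 0%N 1.
    by case=> [|e]; rewrite coef1 /= ?dhomog1 ?dhomog0 ?rpred0.
  have QM d e P P' : Q d P -> Q e P' -> Q (d + e)%N (P * P').
    move=> hP hP' {}i; rewrite coefM; apply: rpred_sum => j _.
    have -> : (d + e + i = (d + j) + (e + (i - j)))%N.
      by rewrite addnACA subnKC // -ltnS.
    exact: dhomogM.
  have QX j : Q 1%N (('X_j)%:P + ('X_j ^+ 2)%:P * 'X).
    have -> : ('X_j)%:P + ('X_j ^+ 2)%:P * 'X = total_sq 'X_j
        :> {poly {mpoly 'F_2[k]}} by rewrite /total_sq mmapX mmap1U.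
    move=> {}i; rewrite -/(steenrod_sq i _) var.
    case: i => [|[|e]] /=; rewrite ?addr0 ?add0r ?rpred0 //.
      by rewrite mulr1n dhomogX /= mdeg1.
    by rewrite mulr1n mpolyXn dhomogX /= mdegMn mdeg1.
  have QXn j e : Q e ((('X_j)%:P + ('X_j ^+ 2)%:P * 'X) ^+ e).
    by elim: e => [|e IH]; rewrite ?expr0 // exprS -add1n; apply: QM.
  suff: Q (mdeg m) (total_sq 'X_[m]) by apply.
  rewrite total_sqX mdegE.
  by elim/big_rec2: _ => // j e P _ hP; apply: QM.
- move=> p; rewrite [RHS]mpolyE [in LHS](mpolyE p) linear_sum /=.
  apply: eq_bigr => m _; rewrite linearZ /= /steenrod_sq total_sqX; congr (_ *: _).
  rewrite -horner_coef0 horner_prod mpolyXE_id; apply: eq_bigr => j _.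
  by rewrite horner_exp !hornerE ?mulr0 ?addr0.
- by move=> j; rewrite /= var mulr0n mulr1n add0r.
- by move=> [|[|i]] j //= _; rewrite /= var !mulr0n addr0.
- by move=> [|i] // _; rewrite /= /steenrod_sq sq1 coef1.
- move=> n f g; rewrite /= /steenrod_sq -coefM; congr (_`_n).
  by rewrite /total_sq rmorphM.
Qed.

(* Main.v *)
(** The point is that the squares [Sq (2 ^ j)] already produce all hit
    polynomials; the rest is linear algebra. The total square
    [P(t) = sum_i Sq^i t^i] is a ring morphism, so the Bullett-Macdonald identity
    [P(s^2 + s t) P(t^2) = P(t^2 + s t) P(s^2)] need only be checked on the
    variables. In bidegree [2n] and modulo the images of [Sq^a], [0 < a < n], it
    reads [Sq^n (t^(2n) + s^(2n) + (s + t)^n (s^n + t^n)) = 0], and the coefficient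
    of [s^(2n-i) t^i] for [0 < i < n] is ['C(n, i) Sq^n]. When [n] is not a power
    of 2, the largest power of 2 below [n] gives an [i] with ['C(n, i)] odd. *)

From HB Require Import structures.
Require Import Defs.
From mathcomp Require Import all_boot all_order all_algebra.
From mathcomp Require Import mpoly.
From mathcomp Require Import ring.
Import GRing.Theory.
Local Open Scope ring_scope.

(** * Composites of two total squares *)

HB.instance Definition _ {k : nat} :=
  GRing.RMorphism.copy (@total_sq k)
    (mmap (polyC \o @mpolyC k 'F_2)
       (fun j => ('X_j)%:P + ('X_j ^+ 2)%:P * 'X)).

(* [sq_sq u v p] is the sum of the [Sq^a (Sq^b p) u^a v^b], see [sq_sqE]; it is
   built as a composite of ring morphisms so as to inherit that structure. *)
Definition sq_sq {k : nat} (u v : {poly {mpoly 'F_2[k]}}) :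
    {mpoly 'F_2[k]} -> {poly {mpoly 'F_2[k]}} :=
  horner_eval v \o map_poly (comp_poly u \o @total_sq k) \o @total_sq k.

HB.instance Definition _ {k : nat} u v := GRing.RMorphism.on (@sq_sq k u v).

Lemma total_sqXj {k : nat} (j : 'I_k) :
  total_sq 'X_j = ('X_j)%:P + ('X_j ^+ 2)%:P * 'X.
Proof. by rewrite /total_sq mmapX mmap1U. Qed.

Lemma total_sqC {k : nat} (c : 'F_2) : total_sq c%:MP_[k] = (c%:MP_[k])%:P.
Proof. by rewrite /total_sq mmapC. Qed.

Lemma sq_sqC {k : nat} u v (c : 'F_2) :
  sq_sq u v c%:MP_[k] = (c%:MP_[k])%:P.
Proof.
by rewrite /sq_sq /= total_sqC map_polyC /horner_eval hornerC /= total_sqC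
  comp_polyC.
Qed.

Lemma poly_mpolyF2_pchar {k : nat} : 2 \in [pchar {poly {mpoly 'F_2[k]}}].
Proof. by rewrite pchar_poly inE /= -mpolyC_nat pchar_Fp_0. Qed.

(** The cross term of [('X_j + 'X_j ^+ 2 * u) ^+ 2] vanishes in characteristic 2; what remains
    depends only on [u + v] and [u ^+ 2 * v]. *)
Lemma sq_sqXj {k : nat} u v (j : 'I_k) :
  sq_sq u v 'X_j =
    ('X_j)%:P + ('X_j ^+ 2)%:P * (u + v) + ('X_j ^+ 4)%:P * (u ^+ 2 * v).
Proof.
rewrite /sq_sq /= total_sqXj rmorphD rmorphM /= map_polyX !map_polyC /=.
rewrite !rmorphXn /= total_sqXj /horner_eval !hornerE !rmorphD !rmorphM /=.
rewrite comp_polyX !comp_polyC sqrrD.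
have -> x : x *+ 2 = 0 :> {poly {mpoly 'F_2[k]}}.
  by rewrite -mulr_natr (pcharf0 poly_mpolyF2_pchar) mulr0.
ring.
Qed.

(* The case [s = 1] of the identity [P(s^2 + s t) P(t^2) = P(t^2 + s t) P(s^2)];
   the degree of polynomials makes up for the lost homogeneity in [s, t]. *)
Lemma bullett_macdonald {k : nat} (p : {mpoly 'F_2[k]}) :
  sq_sq (1 + 'X) ('X ^+ 2) p = sq_sq ('X + 'X ^+ 2) 1 p.
Proof.
rewrite (mpolyE p) !rmorph_sum; apply: eq_bigr => m _.
rewrite -mul_mpolyC !rmorphM /=; congr (_ * _).
  by rewrite !sq_sqC.
rewrite mpolyXE_id !rmorph_prod /=; apply: eq_bigr => j _.
(* Both substitutions give [u + v = 1 + 'X + 'X ^+ 2] and [u ^+ 2 * v = ('X + 'X ^+ 2) ^+ 2]. *)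
rewrite !rmorphXn /= !sq_sqXj; congr (_ ^+ _); ring.
Qed.

Lemma sq_sqE {k : nat} u v (p : {mpoly 'F_2[k]}) (N : nat) :
    (size (total_sq p) <= N)%N ->
    (forall b, (size (total_sq (total_sq p)`_b) <= N)%N) ->
  sq_sq u v p =
    \sum_(b < N) \sum_(a < N)
      ((total_sq (total_sq p)`_b)`_a)%:P * (u ^+ a * v ^+ b).
Proof.
move=> hN hNb; rewrite /sq_sq /= /horner_eval (horner_coef_wide (n := N)); last first.
  exact: leq_trans (size_poly _ _) hN.
apply: eq_bigr => b _; rewrite coef_map /= /comp_poly (horner_coef_wide (n := N)).
  by rewrite mulr_suml; apply: eq_bigr => a _; rewrite coef_map /= mulrA.
exact: leq_trans (size_poly _ _) (hNb b).
Qed.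

(** The Cartan formula carries agreement from the variables to all monomials, and linearity to all
    polynomials. This transfers identities on [total_sq] to any [Sq] satisfying the axioms. *)
Lemma Sq_eq_steenrod_sq {k : nat}
    {Sq : nat -> {linear {mpoly 'F_2[k]} -> {mpoly 'F_2[k]}}} :
  steenrod_squares Sq -> forall i p, Sq i p = (total_sq p)`_i.
Proof.
move=> hSq.
pose Q p := forall i, Sq i p = (total_sq p)`_i.
have Q1 : Q 1.
  move=> [|i]; rewrite /total_sq rmorph1 coef1; first by rewrite (Sq_id hSq).
  by rewrite (Sq_one hSq).
have QM p q : Q p -> Q q -> Q (p * q).
  move=> hp hq i; rewrite (Sq_Cartan hSq) /total_sq rmorphM coefM.
  by apply: eq_bigr => j _; rewrite hp hq.
have QX j : Q 'X_j.
  move=> i; rewrite /total_sq mmapX mmap1U coefD coefC coefMX coefC.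
  case: i => [|[|i]]; rewrite /= ?addr0 ?add0r.
  - by rewrite (Sq_id hSq).
  - by rewrite (Sq_var1 hSq).
  - by rewrite (Sq_var_gt1 hSq).
have QXn j e : Q ('X_j ^+ e).
  elim: e => [|e IH]; first by rewrite expr0; exact: Q1.
  by rewrite exprS; exact: (QM _ _ (QX j) IH).
have QXm m : Q 'X_[m].
  rewrite mpolyXE_id; elim/big_rec: _ => [|j p _ Qp]; first exact: Q1.
  exact: (QM _ _ (QXn j (m j)) Qp).
move=> i p; rewrite (mpolyE p) linear_sum /total_sq raddf_sum coef_sum /=.
apply: eq_bigr => m _; rewrite linearZ /= (QXm m).
by rewrite mmapZ /= coefCM mul_mpolyC.
Qed.

(** * Binomial coefficients modulo 2 *)

Lemma coef_1DXn (R : nzRingType) (a i : nat) :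
  ((1 + 'X) ^+ a : {poly R})`_i = 'C(a, i)%:R.
Proof.
rewrite addrC exprD1n coef_sum; case: (leqP i a) => [le_ia|lt_ai].
  rewrite (bigD1 (Ordinal (le_ia : (i < a.+1)%N))) //= coefMn coefXn eqxx.
  rewrite big1 ?addr0 // => j; rewrite -val_eqE /= coefMn coefXn eq_sym => /negbTE ->.
  by rewrite mul0rn.
rewrite bin_small // big1 // => j _; rewrite coefMn coefXn.
by rewrite gtn_eqF ?mul0rn // (leq_trans (ltn_ord j)).
Qed.

(** By Frobenius, [(1 + 'X) ^+ (2 ^ n + r)] is [(1 + 'X ^+ (2 ^ n)) * (1 + 'X) ^+ r] over ['F_2],
    and the second factor has degree below [2 ^ n]. *)
Lemma odd_bin_pow2 (r n : nat) : (r < 2 ^ n)%N -> odd 'C(2 ^ n + r, 2 ^ n).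
Proof.
move=> lt_r; have h2 : 2 \in [pchar {poly 'F_2}] by rewrite pchar_poly pchar_Fp.
have := coef_1DXn 'F_2 (2 ^ n + r) (2 ^ n).
rewrite exprD exprDn_pchar; last by rewrite pnatX (pnatE _ (isT : prime 2)) h2.
rewrite expr1n mulrDl mul1r coefD coefXnM ltnn subnn !coef_1DXn.
rewrite bin_small // add0r bin0 => /(congr1 val) /=.
by rewrite val_Fp_nat //= modn2; case: odd.
Qed.

(** * Decomposition into the squares [Sq (2 ^ j)] *)

(* The coefficient of [t^i] in [bullett_macdonald]. *)
Lemma Sq_Sq_relation {k : nat}
    {Sq : nat -> {linear {mpoly 'F_2[k]} -> {mpoly 'F_2[k]}}}
    (hSq : steenrod_squares Sq) (p : {mpoly 'F_2[k]}) (n i : nat) :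
  exists2 N, (n < N)%N &
    \sum_(b < N) \sum_(a < N)
      Sq a (Sq b p) *+ (if i < 2 * b then 0 else 'C(a, i - 2 * b))%N =
    \sum_(b < N) \sum_(a < N)
      Sq a (Sq b p) *+ (if i < a then 0 else 'C(a, i - a))%N.
Proof.
have [N [lt_nN hN hNb]] : exists N, [/\ (n < N)%N, (size (total_sq p) <= N)%N &
    forall b, (size (total_sq (total_sq p)`_b) <= N)%N].
  move: (total_sq p) => q.
  pose f b := size (total_sq q`_b); move def_s: (size q) => s.
  (* A maximum over [b < s] suffices, since the later coefficients of [q] are zero. *)
  exists (n.+1 + (s + \max_(b < s) f b))%N.
  split=> [||b]; first exact: leq_addr.
    exact: leq_trans (leq_addr _ _) (leq_addl _ _).
  apply: (leq_trans _ (leq_addl _ _)); apply: (leq_trans _ (leq_addl _ _)).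
  have [lt_b|ge_b] := ltnP b s; first exact: (leq_bigmax (Ordinal lt_b)).
  by rewrite nth_default ?def_s // raddf0 size_poly0.
exists N => //.
have := congr1 (fun q : {poly _} => q`_i) (bullett_macdonald p).
rewrite !(sq_sqE _ _ _ _ hN hNb) !coef_sum => eq_coef.
transitivity (\sum_(b < N) (\sum_(a < N) ((total_sq (total_sq p)`_b)`_a)%:P *
    ((1 + 'X) ^+ a * 'X^2 ^+ b))`_i); [|rewrite eq_coef].
  apply: eq_bigr => b _; rewrite coef_sum; apply: eq_bigr => a _.
  rewrite !(Sq_eq_steenrod_sq hSq) coefCM -exprM coefMXn coef_1DXn.
  by case: ifP => _; rewrite ?mulr0 // mulr_natr.
apply: eq_bigr => b _; rewrite coef_sum; apply: eq_bigr => a _.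
have -> : 'X + 'X^2 = 'X * (1 + 'X) :> {poly {mpoly 'F_2[k]}} by ring.
rewrite !(Sq_eq_steenrod_sq hSq) coefCM expr1n mulr1 exprMn coefXnM coef_1DXn.
by case: ifP => _; rewrite ?mulr0 // mulr_natr.
Qed.

(** Strong induction on [n]. [K] is abstract so that it can later be the set of polynomials whose
    coordinates lie in the column space of [M]. *)
Lemma Sq_decomposable {k : nat}
    {Sq : nat -> {linear {mpoly 'F_2[k]} -> {mpoly 'F_2[k]}}} {d : nat}
    {K : {mpoly 'F_2[k]} -> Prop} :
    steenrod_squares Sq -> K 0 -> (forall p q, K p -> K q -> K (p + q)) ->
    (forall j e g, g \is e.-homog -> (e + 2 ^ j)%N = d -> K (Sq (2 ^ j)%N g)) ->
  forall n e g, (0 < n)%N -> g \is e.-homog -> (e + n)%N = d -> K (Sq n g).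
Proof.
move=> hSq K0 KD Kpow n.
have KMn p m : K p -> K (p *+ m).
  by move=> Kp; elim: m => [|m IH]; rewrite ?mulr0n // mulrS; apply: (KD _ _).
have addKF (p q : {mpoly 'F_2[k]}) : p + q + q = p.
  rewrite -addrA -mulr2n -mulr_natr.
  have -> : 2%:R = 0 :> {mpoly 'F_2[k]}; last by rewrite mulr0 addr0.
  by rewrite -mpolyC_nat pchar_Fp_0.
elim/ltn_ind: n => n IH e g n_gt0 g_homog def_d.
have /andP[] := trunc_log_bounds (isT : (1 < 2)%N) n_gt0.
set m := trunc_log 2 n; rewrite leq_eqVlt => /predU1P[def_n _|lt_n].
  by rewrite -def_n; apply: Kpow g_homog _; rewrite def_n.
rewrite expnS mul2n -addnn => lt_n2.
(* By maximality of [m], [n] is [2 ^ m + r] with [r < 2 ^ m]. *)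
have odd_n : odd 'C(n, 2 ^ m).
  by rewrite -(subnKC (ltnW lt_n)) odd_bin_pow2 // ltn_subLR // ltnW.
have pow_gt0 : (0 < 2 ^ m)%N by rewrite expn_gt0.
move: (2 ^ m)%N odd_n pow_gt0 lt_n => i odd_n i_gt0 lt_in {m lt_n2}.
have [N lt_nN rel] := Sq_Sq_relation hSq g n i.
(* Only the terms with [a + b = n] survive in degree [d]; among them those with
   [0 < a < n] are in [K] by induction, so [a = 0] and [a = n] remain. *)
have Kterm a b c : (a = 0%N -> b = n -> c = 0%N) -> (a = n -> b = 0%N -> c = 0%N) ->
    K (pihomog mdeg d (Sq a (Sq b g) *+ c)).
  move=> c0 cn; rewrite pihomogMn.
  have hb := Sq_homog hSq b g_homog; have hab := Sq_homog hSq a hb.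
  have [eq_d|ne_d] := eqVneq (e + b + a)%N d; last first.
    by rewrite (pihomog_ne0 ne_d hab) mul0rn.
  rewrite pihomog_dE -?eq_d //.
  have eq_n : (b + a)%N = n by apply/eqP; rewrite -(eqn_add2l e) addnA eq_d def_d.
  case: (posnP a) => [a0|a_gt0].
    by rewrite c0 ?mulr0n //; rewrite -eq_n a0 addn0.
  case: (posnP b) => [b0|b_gt0].
    by rewrite cn ?mulr0n //; rewrite -eq_n b0.
  apply: KMn; apply: IH hb _ => //; by rewrite -eq_n -[ltnLHS]add0n ltn_add2r.
have := congr1 (pihomog mdeg d) rel; rewrite !raddf_sum /=.
set rhs := (RHS) => eq_rhs.
have Krhs : K rhs.
  rewrite /rhs; elim/big_rec: _ => // b p _; apply: (KD _ _).
  rewrite raddf_sum /=; elim/big_rec: _ => // a q _; apply: (KD _ _).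
  (* At [a = n] the coefficient is zero because [i < n]; at [a = 0] it is ['C(0, i)] with
     [i > 0]. *)
  apply: Kterm => [-> _|-> _]; last by rewrite lt_in.
  by rewrite ltn0 subn0 bin0n gtn_eqF.
(* Isolates the term [b = 0], [a = n], whose coefficient is the odd ['C(n, i)]. *)
move: eq_rhs; rewrite (bigD1 (Ordinal (leq_ltn_trans (leq0n n) lt_nN))) //=.
rewrite raddf_sum (bigD1 (Ordinal lt_nN)) //= (Sq_id hSq) muln0 subn0.
set s1 := \sum_(a < N | _) _; set s2 := \sum_(b < N | _) _.
have Ks1 : K s1.
  rewrite /s1; elim/big_rec: _ => // a q ne_a; apply: (KD _ _).
  rewrite -[X in Sq a X](Sq_id hSq); apply: Kterm => [_ e0|e_a]; last first.
    by case/eqP: ne_a; apply/val_inj.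
  by rewrite -e0 in n_gt0.
have Ks2 : K s2.
  rewrite /s2; elim/big_rec: _ => // b p ne_b; apply: (KD _ _).
  rewrite raddf_sum /=; elim/big_rec: _ => // a q _; apply: (KD _ _).
  apply: Kterm => [_ ->|_ e_b].
    by rewrite mul2n -addnn (ltn_addr _ lt_in).
  by case/eqP: ne_b; apply/val_inj.
rewrite -addrA pihomogMn pihomog_dE; last first.
  by rewrite -def_d; apply: (Sq_homog hSq).
have -> : Sq n g *+ 'C(n, i) = Sq n g.
  rewrite -(odd_double_half 'C(n, i)) odd_n -addnn mulrnDr mulr1n mulrnDr addrA.
  exact: addKF.
(* Adding [s1 + s2] to both sides cancels it on the left, in characteristic 2. *)
move=> eq_s; rewrite -(addKF (Sq n g) (s1 + s2)) eq_s.
by apply: (KD _ _) => //; apply: (KD _ _).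
Qed.

(** * From generators to the rank *)

Theorem theorem2p3 (k d : nat)
    (Sq : nat -> {linear {mpoly 'F_2[k.+1]} -> {mpoly 'F_2[k.+1]}})
    (hSq : steenrod_squares Sq)
    (phi : {linear dhomog k.+1 'F_2 d -> 'cV['F_2]_(nb_monomials k.+1 d)})
    (phi_iso : bijective phi)
    (n : nat) (M : 'M['F_2]_(nb_monomials k.+1 d, n))
    (hM : forall v : 'cV['F_2]_(nb_monomials k.+1 d),
      (exists j : 'I_n, col j M = v) <->
      (exists2 h : dhomog k.+1 'F_2 d, in_hit_gen Sq d h & phi h = v)) :
  \dim (hit_space Sq d) = \rank M.
Proof.
have [psi phiK psiK] := phi_iso.
pose row_phi f := (phi f)^T.
have gen_hit (f : dhomog k.+1 'F_2 d) : in_hit_gen Sq d f -> f \in hit_space Sq d.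
  move=> [j [m [def_d def_f]]]; apply/(mem_hit_space f hSq).
  have m_homog : ('X_[m] : {mpoly 'F_2[k.+1]}) \is (d - 2 ^ j).-homog.
    by rewrite dhomogX /= -def_d addnK.
  have pow_gt0 : (0 < 2 ^ j)%N by rewrite expn_gt0.
  (* The projection only gives each value its dependent type; at [i = 2 ^ j] it fixes ['X_[m]]. *)
  exists (fun i => if i == (2 ^ j)%N then DHomog (pihomogP mdeg (d - i) 'X_[m]) else 0).
  have pow_d : (2 ^ j < d.+1)%N by rewrite ltnS -def_d leq_addl.
  rewrite (bigD1_seq (2 ^ j)%N) ?mem_index_iota ?pow_gt0 ?iota_uniq //=.
  rewrite eqxx /= pihomog_dE // def_f big1 ?addr0 // => i /negbTE ->.
  by rewrite linear0.
have gen_row (f : dhomog k.+1 'F_2 d) : in_hit_gen Sq d f -> (row_phi f <= M^T)%MS.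
  move=> gen_f; have [_ in_col] := hM (phi f).
  have [|c def_c] := in_col; first by exists f.
  by rewrite /row_phi -def_c tr_col row_sub.
have hit_row f : f \in hit_space Sq d -> (row_phi f <= M^T)%MS.
  move=> /(mem_hit_space f hSq)[g def_f].
  pose K p := exists2 h : dhomog k.+1 'F_2 d, val h = p & (row_phi h <= M^T)%MS.
  suff [h /val_inj -> //] : K f.
  have K0 : K 0 by exists 0; rewrite // /row_phi linear0 trmx0 sub0mx.
  have KD p q : K p -> K q -> K (p + q).
    move=> [hp <- Mp] [hq <- Mq]; exists (hp + hq); first by [].
    by rewrite /row_phi !linearD addmx_sub.
  have KZ c p : K p -> K (c *: p).
    move=> [hp <- Mp]; exists (c *: hp); first by [].
    by rewrite /row_phi !linearZ scalemx_sub.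
  rewrite def_f big_seq; elim/big_rec: _ => // i p; rewrite mem_index_iota.
  move=> /andP[i_gt0 le_id] Kp; apply: (KD _ _) => //.
  apply: (Sq_decomposable (d := d) hSq K0 KD _ _ _ _ i_gt0 (dhomog_is_dhomog (g i))).
    move=> j e q /dhomogP q_homog def_d.
    rewrite (mpolyE q) linear_sum big_seq; elim/big_rec: _ => // m r m_in Kr.
    apply: (KD _ _) => //; rewrite linearZ; apply: KZ.
    have sq_homog : Sq (2 ^ j)%N 'X_[m] \is d.-homog.
      by rewrite -def_d; apply: (Sq_homog hSq); rewrite dhomogX /= q_homog.
    have gen_sq : in_hit_gen Sq d (DHomog sq_homog).
      by exists j, m; rewrite q_homog.
    by exists (DHomog sq_homog); last exact: gen_row.
  by rewrite subnK.
pose b := vbasis (hit_space Sq d).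
(* The rows of [B] are independent because [phi] is injective; it remains to show that [B] and [M^T]
   have the same row space. *)
pose B := \matrix_(i < \dim (hit_space Sq d)) row_phi b`_i.
have mulB u : u *m B = row_phi (\sum_i u 0 i *: b`_i).
  rewrite mulmx_sum_row /row_phi !linear_sum; apply: eq_bigr => i _.
  by rewrite rowK !linearZ.
have B_free : row_free B.
  apply: inj_row_free => u; rewrite mulB => /(congr1 trmx).
  rewrite trmxK trmx0 -(linear0 phi) => /(can_inj phiK) u0.
  have /freeP := basis_free (vbasisP (hit_space Sq d)).
  by move=> /(_ _ u0) u_eq0; apply/rowP => i; rewrite mxE u_eq0.
rewrite -(eqP B_free) -(mxrank_tr M); apply/eqmx_rank/andP; split.
  apply/row_subP => i; rewrite rowK; apply: hit_row.
  by apply: vbasis_mem; rewrite mem_nth ?size_tuple.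
apply/row_subP => j; have [/(_ (ex_intro _ j erefl))[h gen_h def_h] _] := hM (col j M).
rewrite -tr_col -def_h -/(row_phi h) (coord_vbasis (gen_hit h gen_h)).
apply/submxP; exists (\row_i coord b i h); rewrite mulB; congr row_phi.
by apply: eq_bigr => i _; rewrite mxE.
Qed.
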